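(* Let $\varPhi\subset\mathbb{E}^3$ be a skew ruled surface with a polar normalization $\overline{y}$, and let $q$ be its support function. The rotation $\mathrm{curl}^G\overline{T}$ of the Tchebychev vector field $\overline{T}$ with respect to the relative metric $G$ of $\varPhi$ vanishes identically, and its potential is given by $$\tau(u,v)=\ln\frac{w\,q}{|\delta|^{1/2}}+c,\qquad c\in\mathbb{R}.$$
   Context: $\varPhi=(U,\overline{x})$ is a ruled $C^r$-surface ($r\ge 3$) of nonvanishing Gaussian curvature in Euclidean space $\mathbb{E}^3$, given by an injective $C^r$-immersion on $U=I\times\mathbb{R}$ ($I\subset\mathbb{R}$ an open interval) in standard parameters $u^1=u\in I$, $u^2=v\in\mathbb{R}$: $\overline{x}(u,v)=\overline{s}(u)+v\,\overline{e}(u)$, $|\overline{e}|=|\overline{e}'|=1$, $\langle\overline{s}',\overline{e}'\rangle=0$, where $'=d/du$. Put $\overline{n}=\overline{e}'$, $\overline{z}=\overline{e}\times\overline{n}$. The fundamental invariants are $\delta(u)=(\overline{s}',\overline{e},\overline{e}')$ (distribution parameter, nowhere zero), $\kappa(u)=(\overline{e},\overline{e}',\overline{e}'')$ (conical curvature), and $\lambda(u)=\cot\sigma$, where $\sigma=\sphericalangle(\overline{e},\overline{s}')$ is the striction ($-\pi/2<\sigma\le\pi/2$, $\mathrm{sign}\,\sigma=\mathrm{sign}\,\delta$), so that $\overline{e}'=\overline{n}$, $\overline{n}'=-\overline{e}+\kappa\overline{z}$, $\overline{z}'=-\kappa\overline{n}$, $\overline{s}'=\delta\lambda\overline{e}+\delta\overline{z}$.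 Let $w=\sqrt{\delta^2+v^2}$; the unit normal is $\overline{\xi}=(\delta\overline{n}-v\overline{z})/w$. A subscript $/i$ denotes the partial derivative with respect to $u^i$. A relative normalization of $\varPhi$ is a $C^s$-map $\overline{y}:U\to\mathbb{R}^3$, $1\le s<r$, such that at every point $\{\overline{x}_{/1},\overline{x}_{/2},\overline{y}\}$ has rank 3 and $\{\overline{x}_{/1},\overline{x}_{/2},\overline{y}_{/i}\}$ has rank 2 for $i=1,2$. Its support function is $q=\langle\overline{\xi},\overline{y}\rangle$, which never vanishes on $U$ and determines $\overline{y}$ uniquely. The normalization is called polar if at each point $P$ of $\varPhi$ the relative normal (the line through $P$ in the direction of $\overline{y}$) lies on the polar plane, i.e. the plane through $P$ spanned by $\overline{n}$ and $\overline{z}$; the support function is then of the form $q=f(V)$ with $f$ a $C^2$-function of $$V=\arctan\frac{v}{\delta}-\int\kappa\,du.$$ The relative metric $G$ has coefficients $G_{ij}=q^{-1}h_{ij}$, where $h_{ij}$ are the coefficients of the second fundamental form: $h_{11}=-(\kappa w^2+\delta'v-\delta^2\lambda)/w$, $h_{12}=\delta/w$, $h_{22}=0$; $G^{(ij)}$ denotes the inverse matrix. The Darboux tensor is $A_{ijk}=q^{-1}\langle\overline{\xi},\nabla^G_k\nabla^G_j\overline{x}_{/i}\rangle$, where $\nabla^G_i$ is the covariant derivative with respect to $G$ in the direction of $u^i$; indices are raised with $G$. The Tchebychev vector field is $\overline{T}=T^m\overline{x}_{/m}$ with $T^m=\tfrac12A_i^{im}$. Its rotation with respect to $G$ is $$\mathrm{curl}^G\overline{T}=\frac{(G_{12}T^1+G_{22}T^2)_{/1}-(G_{11}T^1+G_{12}T^2)_{/2}}{|\det(G_{ij})|^{1/2}}.$$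 A potential of $\overline{T}$ (with respect to $G$) is a function $\tau$ with $T^i=G^{(ij)}\tau_{/j}$, i.e. $\overline{T}$ is the $G$-gradient of $\tau$.
   Formalization: The potential is stated as ln|w q/|δ|^{1/2}| + c, with an absolute value inside the logarithm, because q may be negative (e.g. for the normalization −ξ, where q = −1) and the displayed logarithm is then undefined; for q > 0 the formulas coincide. *)

(* Defs.v *)
From Stdlib Require Import Reals List.
From Coquelicot Require Import Coquelicot.
Import ListNotations.
Open Scope R_scope.

(** * Euclidean space E^3 *)

(* Addition, scaling and zero are Coquelicot's [plus], [scal], [zero] on the
   product module. *)
Definition E3 : Type := (R * R * R)%type.

Definition c1 (a : E3) : R := fst (fst a).
Definition c2 (a : E3) : R := snd (fst a).
Definition c3 (a : E3) : R := snd a.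

Definition dot (a b : E3) : R := c1 a * c1 b + c2 a * c2 b + c3 a * c3 b.

Definition cross (a b : E3) : E3 :=
  (c2 a * c3 b - c3 a * c2 b,
   c3 a * c1 b - c1 a * c3 b,
   c1 a * c2 b - c2 a * c1 b).

Definition triple (a b c : E3) : R := dot a (cross b c).

Definition enorm (a : E3) : R := sqrt (dot a a).

Fixpoint lincomb (c : list R) (l : list E3) : E3 :=
  match c, l with
  | t :: c', a :: l' => plus (scal t a) (lincomb c' l')
  | _, _ => zero
  end.

Definition lin_indep (l : list E3) : Prop :=
  forall c : list R, length c = length l ->
    lincomb c l = zero -> List.Forall (fun t => t = 0) c.

(* Linearly independent lists have no repetitions, so [incl] (rather than
   a sublist relation) is enough here. *)
Definition has_rank (l : list E3) (k : nat) : Prop :=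
  (exists l', incl l' l /\ lin_indep l' /\ length l' = k) /\
  (forall l', incl l' l -> lin_indep l' -> (length l' <= k)%nat).

Definition line (P d : E3) : E3 -> Prop :=
  fun Q => exists t : R, Q = plus P (scal t d).

Definition plane (P a b : E3) : E3 -> Prop :=
  fun Q => exists t t' : R, Q = plus P (plus (scal t a) (scal t' b)).

(** * Differentiation *)

Definition vDerive (f : R -> E3) (t : R) : E3 :=
  (Derive (fun t => c1 (f t)) t,
   Derive (fun t => c2 (f t)) t,
   Derive (fun t => c3 (f t)) t).

(* The indices 1, 2 of the parameters u^1 = u, u^2 = v. *)
Inductive idx : Type := i1 | i2.

Definition isum (F : idx -> R) : R := F i1 + F i2.
Definition vsum (F : idx -> E3) : E3 := plus (F i1) (F i2).

Definition pd (i : idx) (f : R -> R -> R) (u v : R) : R :=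
  match i with
  | i1 => Derive (fun t => f t v) u
  | i2 => Derive (fun t => f u t) v
  end.

Definition vpd (i : idx) (f : R -> R -> E3) (u v : R) : E3 :=
  match i with
  | i1 => vDerive (fun t => f t v) u
  | i2 => vDerive (fun t => f u t) v
  end.

(* Class C^k on a set [D], intended to be open. *)
Fixpoint Ck (k : nat) (D : R -> R -> Prop) (f : R -> R -> R) : Prop :=
  match k with
  | O => forall u v, D u v -> continuity_2d_pt f u v
  | S k' =>
      (forall u v, D u v ->
         ex_derive (fun t => f t v) u /\ ex_derive (fun t => f u t) v) /\
      Ck k' D (pd i1 f) /\ Ck k' D (pd i2 f)
  end.

Definition vCk (k : nat) (D : R -> R -> Prop) (f : R -> R -> E3) : Prop :=
  Ck k D (fun u v => c1 (f u v)) /\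
  Ck k D (fun u v => c2 (f u v)) /\
  Ck k D (fun u v => c3 (f u v)).

(** * Parametrized surfaces *)

(* For x = s + v e as below, x_{/1} x x_{/2} = delta n - v z has length w, so
   this is xi = (delta n - v z) / w. *)
Definition unit_normal (x : R -> R -> E3) (u v : R) : E3 :=
  let N := cross (vpd i1 x u v) (vpd i2 x u v) in scal (/ enorm N) N.

Definition fform1 (x : R -> R -> E3) (i j : idx) (u v : R) : R :=
  dot (vpd i x u v) (vpd j x u v).

Definition fform2 (x : R -> R -> E3) (i j : idx) (u v : R) : R :=
  dot (unit_normal x u v) (vpd j (vpd i x) u v).

Definition tensor2 : Type := idx -> idx -> R -> R -> R.

Definition det2 (G : tensor2) (u v : R) : R :=
  G i1 i1 u v * G i2 i2 u v - G i1 i2 u v * G i2 i1 u v.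

Definition gauss_curvature (x : R -> R -> E3) (u v : R) : R :=
  det2 (fform2 x) u v / det2 (fform1 x) u v.

Definition inv2 (G : tensor2) : tensor2 :=
  fun i j u v =>
    match i, j with
    | i1, i1 => G i2 i2 u v / det2 G u v
    | i1, i2 => - G i1 i2 u v / det2 G u v
    | i2, i1 => - G i2 i1 u v / det2 G u v
    | i2, i2 => G i1 i1 u v / det2 G u v
    end.

(** * Levi-Civita connection of a metric [G] *)

(* [christoffel G m i j] is Gamma^m_{ij}. *)
Definition christoffel (G : tensor2) (m i j : idx) (u v : R) : R :=
  / 2 * isum (fun l => inv2 G m l u v *
    (pd i (G j l) u v + pd j (G i l) u v - pd l (G i j) u v)).

(* [cov1 G W j i] is nabla_j W_i for an E^3-valued covector field W. *)
Definition cov1 (G : tensor2) (W : idx -> R -> R -> E3)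
    (j i : idx) (u v : R) : E3 :=
  minus (vpd j (W i) u v)
        (vsum (fun m => scal (christoffel G m j i u v) (W m u v))).

(* [cov2 G W k j i] is nabla_k W_{ji} for an E^3-valued covariant 2-tensor W. *)
Definition cov2 (G : tensor2) (W : idx -> idx -> R -> R -> E3)
    (k j i : idx) (u v : R) : E3 :=
  minus (vpd k (W j i) u v)
        (plus (vsum (fun m => scal (christoffel G m k j u v) (W m i u v)))
              (vsum (fun m => scal (christoffel G m k i u v) (W j m u v)))).

(** * Relative differential geometry *)

Definition relative_normalization (k : nat) (U : R -> R -> Prop)
    (x y : R -> R -> E3) : Prop :=
  vCk k U y /\
  forall u v, U u v ->
    has_rank [vpd i1 x u v; vpd i2 x u v; y u v] 3 /\
    forall i, has_rank [vpd i1 x u v; vpd i2 x u v; vpd i y u v] 2.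

Definition support (x y : R -> R -> E3) (u v : R) : R :=
  dot (unit_normal x u v) (y u v).

Definition rel_metric (x y : R -> R -> E3) : tensor2 :=
  fun i j u v => / support x y u v * fform2 x i j u v.

Definition darboux (x y : R -> R -> E3) (i j k : idx) (u v : R) : R :=
  let G := rel_metric x y in
  / support x y u v *
  dot (unit_normal x u v) (cov2 G (cov1 G (fun l => vpd l x)) k j i u v).

(* The components T^m = 1/2 A_i^{im} of the Tchebychev vector field. *)
Definition tchebychev (x y : R -> R -> E3) (m : idx) (u v : R) : R :=
  let G := rel_metric x y in
  / 2 * isum (fun i => isum (fun j => isum (fun k =>
    inv2 G i j u v * inv2 G m k u v * darboux x y i j k u v))).

Definition curl (G : tensor2) (T : idx -> R -> R -> R) (u v : R) : R :=
  (pd i1 (fun u v => G i1 i2 u v * T i1 u v + G i2 i2 u v * T i2 u v) u v -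
   pd i2 (fun u v => G i1 i1 u v * T i1 u v + G i1 i2 u v * T i2 u v) u v)
  / sqrt (Rabs (det2 G u v)).

Definition is_potential (U : R -> R -> Prop) (G : tensor2)
    (T : idx -> R -> R -> R) (tau : R -> R -> R) : Prop :=
  forall u v, U u v ->
    ex_derive (fun t => tau t v) u /\ ex_derive (fun t => tau u t) v /\
    forall i, T i u v = isum (fun j => inv2 G i j u v * pd j tau u v).

(** * Ruled surfaces *)

Definition strip (a b : Rbar) (u v : R) : Prop := Rbar_lt a u /\ Rbar_lt u b.

Definition ruled (s e : R -> E3) (u v : R) : E3 := plus (s u) (scal v (e u)).

Record skew_ruled_surface (r : nat) (a b : Rbar) (s e : R -> E3) : Prop := {
  ruled_Ck : vCk r (strip a b) (ruled s e);
  ruled_injective : forall u v u' v', strip a b u v -> strip a b u' v' ->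
    ruled s e u v = ruled s e u' v' -> u = u' /\ v = v';
  ruled_immersion : forall u v, strip a b u v ->
    has_rank [vpd i1 (ruled s e) u v; vpd i2 (ruled s e) u v] 2;
  ruled_e_unit : forall u, Rbar_lt a u -> Rbar_lt u b -> enorm (e u) = 1;
  ruled_e'_unit : forall u, Rbar_lt a u -> Rbar_lt u b -> enorm (vDerive e u) = 1;
  ruled_striction : forall u, Rbar_lt a u -> Rbar_lt u b ->
    dot (vDerive s u) (vDerive e u) = 0;
  ruled_skew : forall u v, strip a b u v -> gauss_curvature (ruled s e) u v <> 0
}.

Definition n_vec (e : R -> E3) : R -> E3 := vDerive e.

Definition z_vec (e : R -> E3) (u : R) : E3 := cross (e u) (n_vec e u).

Definition delta (s e : R -> E3) (u : R) : R :=
  triple (vDerive s u) (e u) (vDerive e u).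

Definition w_fun (s e : R -> E3) (u v : R) : R := sqrt (delta s e u ^ 2 + v ^ 2).

(* The relative normal lies on the polar plane. *)
Definition polar (U : R -> R -> Prop) (s e : R -> E3) (y : R -> R -> E3) : Prop :=
  forall u v, U u v -> forall Q : E3,
    line (ruled s e u v) (y u v) Q ->
    plane (ruled s e u v) (n_vec e u) (z_vec e u) Q.

(* Main.v *)
(* Put N = x_{/1} x x_{/2} and Q = <N, y>, so that |N| = w and Q = w q.  The
   relative metric is then G_ij = <N, x_{/ij}> / Q, with G_12 = delta / Q and
   G_22 = 0, and w drops out of the Darboux tensor as well.  Since G^11 = 0, only
   the components A_ijk with (i, j) <> (1, 1) enter the Tchebychev vector; this
   matters because for r = 3 the symbol Gamma^2_11 need not be differentiable.
   The remaining components give T_2 = Q_{/2} / Q and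
   T_1 = Q_{/1} / Q - delta' / (2 delta), i.e. T is the gradient of
   ln |Q| - ln |delta| / 2.  As y_{/i} is tangent, Q_{/i} = <N_{/i}, y>, so Q is
   of class C^2 even if y is only C^1, and the rotation vanishes by Schwarz. *)

From Stdlib Require Import Reals List Lra Lia.
From Coquelicot Require Import Coquelicot.
Require Import Defs.
Import ListNotations.
Open Scope R_scope.

Set Bullet Behavior "Strict Subproofs".

(** * Partial derivatives and C^k calculus *)

(** [Derive] is total, so an equation on [pd] alone says nothing about differentiability; this
    relation carries existence together with the value. *)
Definition is_pd (i : idx) (f : R -> R -> R) (u v l : R) : Prop :=
  match i with
  | i1 => is_derive (fun t => f t v) u l
  | i2 => is_derive (fun t => f u t) v l
  end.

Lemma is_pd_unique i f u v l : is_pd i f u v l -> pd i f u v = l.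
Proof. destruct i; apply is_derive_unique. Qed.

Lemma is_pd_const i c u v : is_pd i (fun _ _ => c) u v 0.
Proof. destruct i; cbn; auto_derive; auto. Qed.

Lemma is_pd_snd i u v :
  is_pd i (fun _ v => v) u v (match i with i1 => 0 | i2 => 1 end).
Proof. destruct i; cbn; auto_derive; auto. Qed.

Lemma is_pd_plus i f g u v l m : is_pd i f u v l -> is_pd i g u v m ->
  is_pd i (fun u v => f u v + g u v) u v (l + m).
Proof. destruct i; intros; apply @is_derive_plus; assumption. Qed.

Lemma is_pd_minus i f g u v l m : is_pd i f u v l -> is_pd i g u v m ->
  is_pd i (fun u v => f u v - g u v) u v (l - m).
Proof. destruct i; intros; apply @is_derive_minus; assumption. Qed.

Lemma is_pd_mult i f g u v l m : is_pd i f u v l -> is_pd i g u v m ->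
  is_pd i (fun u v => f u v * g u v) u v (l * g u v + f u v * m).
Proof.
destruct i; cbn; intros F G.
- apply (is_derive_mult (fun t => f t v) (fun t => g t v)); auto; exact Rmult_comm.
- apply (is_derive_mult (fun t => f u t) (fun t => g u t)); auto; exact Rmult_comm.
Qed.

Lemma is_pd_inv i f u v l : f u v <> 0 -> is_pd i f u v l ->
  is_pd i (fun u v => / f u v) u v (- l / f u v ^ 2).
Proof.
destruct i; cbn; intros Z F;
  [apply (is_derive_inv (fun t => f t v)) | apply (is_derive_inv (fun t => f u t))]; auto.
Qed.

Lemma is_pd_eq i f u v l m : l = m -> is_pd i f u v l -> is_pd i f u v m.
Proof. intros <-; auto. Qed.

Lemma is_pd_div i f g u v l m : g u v <> 0 -> is_pd i f u v l -> is_pd i g u v m ->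
  is_pd i (fun u v => f u v / g u v) u v ((l * g u v - f u v * m) / g u v ^ 2).
Proof.
intros Z F H; eapply is_pd_eq; [|exact (is_pd_mult _ _ _ _ _ _ _ F (is_pd_inv _ _ _ _ _ Z H))].
cbv beta; field; exact Z.
Qed.

Lemma is_pd_comp i h f u v l m :
  is_derive h (f u v) m -> is_pd i f u v l ->
  is_pd i (fun u v => h (f u v)) u v (l * m).
Proof.
destruct i; cbn; intros H F;
  [apply (is_derive_comp h (fun t => f t v)) | apply (is_derive_comp h (fun t => f u t))]; auto.
Qed.

Definition open2 (D : R -> R -> Prop) : Prop :=
  forall u v, D u v -> locally_2d D u v.

Lemma is_pd_ext (D : R -> R -> Prop) i f g u v l : open2 D -> D u v ->
  (forall u v, D u v -> f u v = g u v) -> is_pd i f u v l -> is_pd i g u v l.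
Proof.
intros O d E; destruct i; cbn; intros H.
- apply is_derive_ext_loc with (fun t => f t v); [|exact H].
  generalize (locally_2d_1d_const_y _ _ _ (O _ _ d)); apply filter_imp; intros; auto.
- apply is_derive_ext_loc with (fun t => f u t); [|exact H].
  generalize (locally_2d_1d_const_x _ _ _ (O _ _ d)); apply filter_imp; intros; auto.
Qed.

Lemma pd_ext (D : R -> R -> Prop) i f g u v : open2 D -> D u v ->
  (forall u v, D u v -> f u v = g u v) -> pd i f u v = pd i g u v.
Proof.
intros O d E; destruct i; cbn; apply Derive_ext_loc.
- generalize (locally_2d_1d_const_y _ _ _ (O _ _ d)); apply filter_imp; intros; auto.
- generalize (locally_2d_1d_const_x _ _ _ (O _ _ d)); apply filter_imp; intros; auto.
Qed.

Lemma Ck_is_pd k D f i u v : Ck (S k) D f -> D u v -> is_pd i f u v (pd i f u v).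
Proof. intros [H _] d; destruct (H u v d), i; apply Derive_correct; assumption. Qed.

Lemma Ck_pd k D f i : Ck (S k) D f -> Ck k D (pd i f).
Proof. intros (_ & ? & ?); destruct i; assumption. Qed.

Lemma Ck_intro k D f F : (forall i u v, D u v -> is_pd i f u v (F i u v)) ->
  (forall i, Ck k D (pd i f)) -> Ck (S k) D f.
Proof.
intros H C; split; [|split; apply C].
intros u v d; split; [exists (F i1 u v); apply (H i1) | exists (F i2 u v); apply (H i2)]; auto.
Qed.

(** * Closure properties of the class C^k on an open set *)

Section OpenDomain.

Variable D : R -> R -> Prop.
Hypothesis D_open : open2 D.

Lemma Ck_ext k : forall f g, (forall u v, D u v -> f u v = g u v) ->
  Ck k D f -> Ck k D g.
Proof.
induction k as [|k IH]; intros f g E H.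
- intros u v d; apply continuity_2d_pt_ext_loc with f; [|exact (H u v d)].
  apply locally_2d_impl with (2 := D_open u v d), locally_2d_forall; auto.
- apply Ck_intro with (fun i u v => pd i f u v).
  + intros i u v d; apply is_pd_ext with D f; auto; eapply Ck_is_pd; eauto.
  + intros i; apply IH with (pd i f); [|apply Ck_pd; auto].
    intros; eapply pd_ext; eauto.
Qed.

(** The principle behind the inductive closure lemmas: it suffices to exhibit formulas for the first
    partial derivatives that are themselves C^k. *)
Lemma Ck_of_pd k f F : (forall i u v, D u v -> is_pd i f u v (F i u v)) ->
  (forall i, Ck k D (F i)) -> Ck (S k) D f.
Proof.
intros H C; apply Ck_intro with F; auto.
intros i; apply Ck_ext with (F i); auto.
intros u v d; symmetry; apply is_pd_unique; auto.
Qed.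

(** [Ck 1] does not state continuity of [f] itself. Continuous partial derivatives give total
    differentiability, and this gives continuity. *)
Lemma Ck_1_continuous f : Ck 1 D f -> Ck 0 D f.
Proof.
intros H u v d; apply differentiable_continuity_pt.
exists (pd i1 f u v), (pd i2 f u v).
apply filterdiff_differentiable_pt_lim.
apply (is_derive_filterdiff f u v (fun u v => pd i1 f u v) (pd i2 f u v)).
- apply (locally_2d_locally (fun a b => is_derive (fun z => f z b) a (pd i1 f a b))).
  apply locally_2d_impl with (2 := D_open u v d), locally_2d_forall.
  intros a b ab; apply (Ck_is_pd 0 D f i1); auto.
- apply (Ck_is_pd 0 D f i2); auto.
- apply (continuity_2d_pt_filterlim (pd i1 f)); apply H; exact d.
Qed.

Lemma Ck_pred k : forall f, Ck (S k) D f -> Ck k D f.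
Proof.
induction k as [|k IH]; intros f H; [apply Ck_1_continuous; auto|].
apply Ck_of_pd with (fun i => pd i f).
- intros; eapply Ck_is_pd; eauto.
- intros; apply IH, Ck_pd; auto.
Qed.

Lemma Ck_le k m f : (k <= m)%nat -> Ck m D f -> Ck k D f.
Proof. induction 1; auto; intros; apply IHle, Ck_pred; auto. Qed.

Lemma Ck_const k : forall c, Ck k D (fun _ _ => c).
Proof.
induction k; intros c; [intros u v _; apply continuity_2d_pt_const|].
apply Ck_of_pd with (fun _ _ _ => 0); auto; intros; apply is_pd_const.
Qed.

Lemma Ck_snd k : Ck k D (fun _ v => v).
Proof.
destruct k; [intros u v _; apply continuity_2d_pt_id2|].
apply Ck_of_pd with (fun i _ _ => match i with i1 => 0 | i2 => 1 end).
- intros; apply is_pd_snd.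
- intros; apply Ck_const.
Qed.

Lemma Ck_plus k : forall f g, Ck k D f -> Ck k D g ->
  Ck k D (fun u v => f u v + g u v).
Proof.
induction k as [|k IH]; intros f g F G.
- intros u v d; apply continuity_2d_pt_plus; auto.
- apply Ck_of_pd with (fun i u v => pd i f u v + pd i g u v).
  + intros; apply is_pd_plus; eapply Ck_is_pd; eauto.
  + intros; apply IH; apply Ck_pd; auto.
Qed.

Lemma Ck_mult k : forall f g, Ck k D f -> Ck k D g ->
  Ck k D (fun u v => f u v * g u v).
Proof.
induction k as [|k IH]; intros f g F G.
- intros u v d; apply continuity_2d_pt_mult; auto.
- apply Ck_of_pd with (fun i u v => pd i f u v * g u v + f u v * pd i g u v).
  + intros; apply is_pd_mult; eapply Ck_is_pd; eauto.
  + intros; apply Ck_plus; apply IH; auto using Ck_pd, Ck_pred.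
Qed.

Lemma Ck_minus k f g : Ck k D f -> Ck k D g -> Ck k D (fun u v => f u v - g u v).
Proof.
intros F G; apply Ck_ext with (fun u v => f u v + (-1) * g u v); [intros; ring|].
apply Ck_plus, Ck_mult; auto using Ck_const.
Qed.

Lemma Ck_inv k : forall f, (forall u v, D u v -> f u v <> 0) -> Ck k D f ->
  Ck k D (fun u v => / f u v).
Proof.
induction k as [|k IH]; intros f Z F.
- intros u v d; apply continuity_2d_pt_inv; auto.
(* With [/ f] written twice instead of a square, the induction hypothesis applies to each factor. *)
- apply Ck_of_pd with (fun i u v => -1 * pd i f u v * (/ f u v * / f u v)).
  + intros i u v d.
    replace (-1 * pd i f u v * (/ f u v * / f u v)) with (- pd i f u v / f u v ^ 2) by (field; auto).
    apply is_pd_inv; auto; eapply Ck_is_pd; eauto.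
  + intros i; repeat apply Ck_mult; auto using Ck_const, Ck_pd, Ck_pred.
Qed.

Lemma Ck_div k f g : (forall u v, D u v -> g u v <> 0) -> Ck k D f -> Ck k D g ->
  Ck k D (fun u v => f u v / g u v).
Proof. intros; apply Ck_mult; auto using Ck_inv. Qed.

Lemma pd_comm f u v : Ck 2 D f -> D u v ->
  pd i1 (pd i2 f) u v = pd i2 (pd i1 f) u v.
Proof.
intros H d; apply Schwarz.
- apply locally_2d_impl with (2 := D_open u v d), locally_2d_forall.
  intros a b ab; destruct H as [H [[H1 _] [H2 _]]].
  destruct (H a b ab), (H1 a b ab), (H2 a b ab); auto.
- apply (Ck_pd 0 D (pd i2 f) i1); auto; apply Ck_pd; exact H.
- apply (Ck_pd 0 D (pd i1 f) i2); auto; apply Ck_pd; exact H.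
Qed.

End OpenDomain.

(** * Functions on the parameter strip *)

Lemma strip_open a b : open2 (strip a b).
Proof.
intros u v [A B].
assert (H : locally u (fun t => Rbar_lt a t /\ Rbar_lt t b)).
{ apply filter_and; [apply open_Rbar_gt | apply open_Rbar_lt]; auto. }
destruct H as [eps H]; exists eps; intros t w T _; apply H; exact T.
Qed.

(** The strip contains (u, c) along with every (u, v), so restricting to v = c makes sense over the
    whole interval; partial derivatives in u commute with the restriction. *)
Lemma Ck_strip_slice a b c k : forall f, Ck k (strip a b) f ->
  Ck k (strip a b) (fun u _ => f u c).
Proof.
induction k as [|k IH]; intros f H.
- intros u v d eps; destruct (H u c d eps) as [eta E].
  exists eta; intros s t S _; apply E; [exact S|].
  rewrite Rminus_diag, Rabs_R0; apply cond_pos.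
- apply Ck_of_pd with (fun i u _ => match i with i1 => pd i1 f u c | i2 => 0 end).
  + apply strip_open.
  + intros [|] u v d; [exact (Ck_is_pd k (strip a b) f i1 u c H d)|].
    exact (is_pd_const i2 (f u c) u v).
  + intros [|]; [apply (IH (pd i1 f)), (Ck_pd _ _ _ i1); auto | apply Ck_const, strip_open].
Qed.

Lemma strip_inhabited a b v : Rbar_lt a b -> exists p, strip a b p v.
Proof.
destruct a as [p| |], b as [q| |]; intros H; try contradiction.
- exists ((p + q) / 2); cbn in H; split; cbn; lra.
- exists (p + 1); split; cbn; lra.
- exists (q - 1); split; cbn; lra.
- exists 0; split; exact I.
Qed.

(** * Vectors *)

Lemma E3_ext (a b : E3) : c1 a = c1 b -> c2 a = c2 b -> c3 a = c3 b -> a = b.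
Proof. destruct a as [[? ?] ?], b as [[? ?] ?]; cbn; congruence. Qed.

(* The module structures found by unification on [E3] differ syntactically, so
   the coordinates are computed by conversion instead of rewriting. *)
Ltac coord c t :=
  lazymatch t with
  | plus ?a ?b => change (c t) with (c a + c b)
  | minus ?a ?b => change (c t) with (c a - c b)
  | scal ?h ?a => change (c t) with (h * c a)
  | zero => change (c t) with 0
  | cross ?a ?b =>
      lazymatch c with
      | c1 => change (c t) with (c2 a * c3 b - c3 a * c2 b)
      | c2 => change (c t) with (c3 a * c1 b - c1 a * c3 b)
      | c3 => change (c t) with (c1 a * c2 b - c2 a * c1 b)
      end
  end.
Ltac coords := unfold triple, dot; repeat
  match goal with
  | |- context [c1 ?t] => coord c1 t
  | |- context [c2 ?t] => coord c2 t
  | |- context [c3 ?t] => coord c3 t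
  end.
Ltac E3_ring := coords; ring.

Lemma dot_comm a b : dot a b = dot b a.
Proof. E3_ring. Qed.

Lemma dot_plus_r a b c : dot a (plus b c) = dot a b + dot a c.
Proof. E3_ring. Qed.

Lemma dot_minus_r a b c : dot a (minus b c) = dot a b - dot a c.
Proof. E3_ring. Qed.

Lemma dot_scal_r a t b : dot a (scal t b) = t * dot a b.
Proof. E3_ring. Qed.

Lemma dot_scal_l a t b : dot (scal t a) b = t * dot a b.
Proof. E3_ring. Qed.

Lemma dot_zero_r a : dot a zero = 0.
Proof. E3_ring. Qed.

Lemma dot_cross_l a b : dot (cross a b) a = 0.
Proof. E3_ring. Qed.

Lemma dot_cross_r a b : dot (cross a b) b = 0.
Proof. E3_ring. Qed.

Lemma lagrange a b : dot (cross a b) (cross a b) = dot a a * dot b b - dot a b ^ 2.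
Proof. E3_ring. Qed.

(** Gram determinant of a, b, c, expanded along its first row. *)
Lemma triple_sqr a b c : triple a b c ^ 2 =
  dot a a * (dot b b * dot c c - dot b c ^ 2)
  - dot a b * (dot a b * dot c c - dot b c * dot a c)
  + dot a c * (dot a b * dot b c - dot b b * dot a c).
Proof. E3_ring. Qed.

(** Vectors orthogonal to a nonzero n lie in a plane. The proof pairs with n the expansion (a, b, c)
    n = <a, n> b x c + <b, n> c x a + <c, n> a x b. *)
Lemma triple_orthogonal n a b c : dot n n <> 0 ->
  dot a n = 0 -> dot b n = 0 -> dot c n = 0 -> triple a b c = 0.
Proof.
intros Z A B C; apply Rmult_eq_reg_r with (dot n n); [|exact Z].
transitivity (dot a n * triple n b c + dot b n * triple n c a + dot c n * triple n a b).
- E3_ring.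
- rewrite A, B, C; ring.
Qed.

Lemma enorm_eq_1 a : enorm a = 1 -> dot a a = 1.
Proof.
intros H; rewrite <- (sqrt_def (dot a a)).
- fold (enorm a); rewrite H; ring.
- unfold dot; generalize (Rle_0_sqr (c1 a)) (Rle_0_sqr (c2 a)) (Rle_0_sqr (c3 a)); unfold Rsqr; lra.
Qed.

(** * Ranks *)

Lemma lincomb_zeros l : lincomb (repeat 0 (length l)) l = zero.
Proof.
induction l as [|x l IH]; cbn [length repeat lincomb]; [reflexivity|].
rewrite IH; apply E3_ext; E3_ring.
Qed.

(** Three vectors in the span of p and q have a 2 x 3 coordinate matrix with nontrivial kernel; a
    kernel vector padded with zeros is a relation for the whole list. *)
Lemma lin_indep_in_plane_length (p q : E3) l :
  (forall x, In x l -> exists t t', x = plus (scal t p) (scal t' q)) ->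
  lin_indep l -> (length l <= 2)%nat.
Proof.
destruct l as [|x [|y [|z l]]]; cbn [length In]; try lia. intros H I; exfalso.
destruct (H x) as (x1 & x2 & ->); auto.
destruct (H y) as (y1 & y2 & ->); auto.
destruct (H z) as (z1 & z2 & ->); auto.
assert (K : forall f g h, f * x1 + g * y1 + h * z1 = 0 ->
    f * x2 + g * y2 + h * z2 = 0 -> f = 0 /\ g = 0 /\ h = 0).
{ intros f g h P Q.
  assert (Z : List.Forall (fun t => t = 0) (f :: g :: h :: repeat 0 (length l))).
  { apply I; [cbn; rewrite repeat_length; auto|].
    cbn [lincomb].
  transitivity (plus (scal (f * x1 + g * y1 + h * z1) p)
                       (scal (f * x2 + g * y2 + h * z2) q)).
    - rewrite lincomb_zeros; apply E3_ext; E3_ring.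
    - rewrite P, Q; apply E3_ext; E3_ring. }
  inversion Z as [|? ? ? Z2]; inversion Z2 as [|? ? ? Z3]; inversion Z3; auto. }
(* The 2 x 2 minors, i.e. the cross product of the two rows, form a kernel vector and hence vanish.
   The last minor being zero, (y2, -x2, 0) and (y1, -x1, 0) are kernel vectors too, and so is (1, 0,
   0) if the first column is zero. *)
destruct (K (y1 * z2 - y2 * z1) (z1 * x2 - z2 * x1) (x1 * y2 - x2 * y1)) as (_ & _ & ?); try ring.
destruct (Req_dec x1 0) as [E1|E1].
- destruct (Req_dec x2 0) as [E2|E2].
  + destruct (K 1 0 0); subst; lra.
  + destruct (K y2 (- x2) 0) as (_ & ? & _); lra.
- destruct (K y1 (- x1) 0) as (_ & ? & _); lra.
Qed.

(** If the triple product vanished, c would lie in the span of a and b, and independent lists drawn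
    from the three vectors would have length at most 2. *)
Lemma rank_3_triple a b c : dot (cross a b) (cross a b) <> 0 ->
  has_rank [a; b; c] 3 -> dot (cross a b) c <> 0.
Proof.
set (n := cross a b); intros Z [(l & I & L & E) _] H.
enough (length l <= 2)%nat by lia.
apply lin_indep_in_plane_length with a b; [|exact L].
intros x X; destruct (I x X) as [<-|[<-|[<-|[]]]].
- exists 1, 0; apply E3_ext; E3_ring.
- exists 0, 1; apply E3_ext; E3_ring.
- (* Cramer's rule *)
  exists (dot (cross c b) n / dot n n), (dot (cross a c) n / dot n n).
  assert (G : scal (dot n n) c =
    plus (scal (dot (cross c b) n) a) (plus (scal (dot (cross a c) n) b) (scal (dot n c) n))).
  { unfold n; apply E3_ext; E3_ring. }
  rewrite H in G.
  transitivity (scal (/ dot n n) (scal (dot n n) c)).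
  + apply E3_ext; coords; field; exact Z.
  + rewrite G; unfold Rdiv; apply E3_ext; E3_ring.
Qed.

Lemma rank_2_triple a b c : has_rank [a; b; c] 2 -> dot (cross a b) c = 0.
Proof.
intros [_ H]; destruct (Req_dec (dot (cross a b) c) 0) as [|Z]; [assumption|exfalso].
enough (K : (length [a; b; c] <= 2)%nat) by (cbn in K; lia).
apply H; [apply incl_refl|].
intros l L E; destruct l as [|p [|q [|t [|? ?]]]]; try discriminate.
(* Up to the factor (a, b, c), the cross products of pairs form the dual basis, so pairing with them
   isolates each coefficient. *)
assert (P : p * dot (cross a b) c = dot (cross b c) (lincomb [p; q; t] [a; b; c]))
  by (cbn [lincomb]; E3_ring).
assert (Q : q * dot (cross a b) c = dot (cross c a) (lincomb [p; q; t] [a; b; c]))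
  by (cbn [lincomb]; E3_ring).
assert (T : t * dot (cross a b) c = dot (cross a b) (lincomb [p; q; t] [a; b; c]))
  by (cbn [lincomb]; E3_ring).
rewrite E, dot_zero_r in P, Q, T.
apply Rmult_integral in P, Q, T.
repeat constructor; tauto.
Qed.

(** * Vector-valued partial derivatives *)

Definition is_vpd (i : idx) (f : R -> R -> E3) (u v : R) (l : E3) : Prop :=
  is_pd i (fun u v => c1 (f u v)) u v (c1 l) /\
  is_pd i (fun u v => c2 (f u v)) u v (c2 l) /\
  is_pd i (fun u v => c3 (f u v)) u v (c3 l).

Lemma is_vpd_unique i f u v l : is_vpd i f u v l -> vpd i f u v = l.
Proof.
intros (A & B & C); apply is_pd_unique in A, B, C.
destruct i; apply E3_ext; assumption.
Qed.

Lemma is_vpd_ext (D : R -> R -> Prop) i f g u v l : open2 D -> D u v ->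
  (forall u v, D u v -> f u v = g u v) -> is_vpd i f u v l -> is_vpd i g u v l.
Proof.
intros O d E (A & B & C); repeat split;
  [apply is_pd_ext with D (fun u v => c1 (f u v))
  |apply is_pd_ext with D (fun u v => c2 (f u v))
  |apply is_pd_ext with D (fun u v => c3 (f u v))]; auto; intros; rewrite E; auto.
Qed.

Lemma vCk_is_vpd k D f i u v : vCk (S k) D f -> D u v -> is_vpd i f u v (vpd i f u v).
Proof.
intros (A & B & C) d; destruct i; (split; [|split]).
- exact (Ck_is_pd k D _ i1 u v A d).
- exact (Ck_is_pd k D _ i1 u v B d).
- exact (Ck_is_pd k D _ i1 u v C d).
- exact (Ck_is_pd k D _ i2 u v A d).
- exact (Ck_is_pd k D _ i2 u v B d).
- exact (Ck_is_pd k D _ i2 u v C d).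
Qed.

Lemma is_vpd_eq i f u v l m : l = m -> is_vpd i f u v l -> is_vpd i f u v m.
Proof. intros <-; auto. Qed.

Lemma is_vpd_const i c u v : is_vpd i (fun _ _ => c) u v zero.
Proof. split; [|split]; apply is_pd_const. Qed.

Lemma is_vpd_plus i f g u v l m : is_vpd i f u v l -> is_vpd i g u v m ->
  is_vpd i (fun u v => plus (f u v) (g u v)) u v (plus l m).
Proof. intros (?&?&?) (?&?&?); split; [|split]; apply is_pd_plus; assumption. Qed.

Lemma is_vpd_minus i f g u v l m : is_vpd i f u v l -> is_vpd i g u v m ->
  is_vpd i (fun u v => minus (f u v) (g u v)) u v (minus l m).
Proof. intros (?&?&?) (?&?&?); split; [|split]; apply is_pd_minus; assumption. Qed.

Lemma is_vpd_scal i h f u v l m : is_pd i h u v l -> is_vpd i f u v m ->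
  is_vpd i (fun u v => scal (h u v) (f u v)) u v (plus (scal l (f u v)) (scal (h u v) m)).
Proof. intros ? (?&?&?); split; [|split]; apply is_pd_mult; assumption. Qed.

Lemma is_vpd_cross i f g u v l m : is_vpd i f u v l -> is_vpd i g u v m ->
  is_vpd i (fun u v => cross (f u v) (g u v)) u v (plus (cross l (g u v)) (cross (f u v) m)).
Proof.
intros (?&?&?) (?&?&?); (split; [|split]); coords;
 (eapply is_pd_eq; [|apply is_pd_minus; apply is_pd_mult; eassumption]); E3_ring.
Qed.

Lemma is_pd_dot i f g u v l m : is_vpd i f u v l -> is_vpd i g u v m ->
  is_pd i (fun u v => dot (f u v) (g u v)) u v (dot l (g u v) + dot (f u v) m).
Proof.
intros (?&?&?) (?&?&?); unfold dot.
eapply is_pd_eq;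
  [|apply is_pd_plus; [apply is_pd_plus|]; apply is_pd_mult; eassumption]; E3_ring.
Qed.

Section VectorOpenDomain.

Variable D : R -> R -> Prop.
Hypothesis D_open : open2 D.

Lemma vCk_pred k f : vCk (S k) D f -> vCk k D f.
Proof. intros (?&?&?); split; [|split]; apply Ck_pred; auto. Qed.

Lemma vCk_le k m f : (k <= m)%nat -> vCk m D f -> vCk k D f.
Proof. intros ? (?&?&?); split; [|split]; apply Ck_le with m; auto. Qed.

Lemma vCk_plus k f g : vCk k D f -> vCk k D g ->
  vCk k D (fun u v => plus (f u v) (g u v)).
Proof. intros (?&?&?) (?&?&?); split; [|split]; apply (Ck_plus D D_open); assumption. Qed.

Lemma vCk_scal k h f : Ck k D h -> vCk k D f ->
  vCk k D (fun u v => scal (h u v) (f u v)).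
Proof. intros ? (?&?&?); split; [|split]; apply (Ck_mult D D_open); assumption. Qed.

Lemma vCk_cross k f g : vCk k D f -> vCk k D g ->
  vCk k D (fun u v => cross (f u v) (g u v)).
Proof.
intros (?&?&?) (?&?&?); split; [|split]; apply (Ck_minus D D_open); apply (Ck_mult D D_open); assumption.
Qed.

Lemma Ck_dot k f g : vCk k D f -> vCk k D g -> Ck k D (fun u v => dot (f u v) (g u v)).
Proof.
intros (?&?&?) (?&?&?).
apply (Ck_plus D D_open); [apply (Ck_plus D D_open)|]; apply (Ck_mult D D_open); assumption.
Qed.

End VectorOpenDomain.

(** * Ruled surfaces in standard parameters *)

Section Ruled.

Variables (a b : Rbar) (s e : R -> E3).
Let D := strip a b.
Let D_open : open2 D := strip_open a b.

(** A curve is regarded as a map on the strip, so that one calculus of partial derivatives serves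
    both curves and surfaces. *)
Definition along (i : idx) (f : R -> E3) (u : R) : E3 :=
  match i with i1 => vDerive f u | i2 => zero end.

Lemma is_vpd_along k f i u v : vCk (S k) D (fun u _ => f u) -> D u v ->
  is_vpd i (fun u _ => f u) u v (along i f u).
Proof.
intros H d; destruct i; [exact (vCk_is_vpd k D _ i1 u v H d)|].
split; [|split].
- exact (is_pd_const i2 (c1 (f u)) u v).
- exact (is_pd_const i2 (c2 (f u)) u v).
- exact (is_pd_const i2 (c3 (f u)) u v).
Qed.

Lemma vCk_vDerive k f : vCk (S k) D (fun u _ => f u) ->
  vCk k D (fun u _ => vDerive f u).
Proof.
intros (A & B & C); split; [|split].
- exact (Ck_pd _ _ _ i1 A).
- exact (Ck_pd _ _ _ i1 B).
- exact (Ck_pd _ _ _ i1 C).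
Qed.

Lemma is_vpd_ruled k f g i u v :
  vCk (S k) D (fun u _ => f u) -> vCk (S k) D (fun u _ => g u) -> D u v ->
  is_vpd i (ruled f g) u v
    (match i with i1 => ruled (vDerive f) (vDerive g) u v | i2 => g u end).
Proof.
intros F G d.
apply is_vpd_eq with (plus (along i f u)
  (plus (scal (match i with i1 => 0 | i2 => 1 end) (g u)) (scal v (along i g u)))).
2: exact (is_vpd_plus i _ _ u v _ _ (is_vpd_along k f i u v F d)
  (is_vpd_scal i (fun _ v => v) _ u v _ _ (is_pd_snd i u v) (is_vpd_along k g i u v G d))).
destruct i; apply E3_ext; cbn [along]; unfold ruled; E3_ring.
Qed.

Lemma vCk_ruled k f g :
  vCk k D (fun u _ => f u) -> vCk k D (fun u _ => g u) -> vCk k D (ruled f g).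
Proof.
intros F G; apply (vCk_plus D D_open k (fun u _ => f u)); auto.
apply (vCk_scal D D_open k (fun _ v => v) (fun u _ => g u)); auto using Ck_snd.
Qed.

(** Smoothness is given for the surface only; the directrix is its slice v = 0. *)
Lemma vCk_directrix k : vCk k D (ruled s e) -> vCk k D (fun u _ => s u).
Proof.
assert (K : forall c : E3 -> R, (forall u v, c (ruled s e u v) = c (s u) + v * c (e u)) ->
  Ck k D (fun u v => c (ruled s e u v)) -> Ck k D (fun u _ => c (s u))).
{ intros c E H; apply (Ck_strip_slice a b 0) in H.
  apply Ck_ext with (3 := H); auto; intros; cbv beta; rewrite E; ring. }
intros (A & B & C); split; [|split]; apply K; auto.
Qed.

(** The ruling direction is the difference of the slices v = 1 and v = 0. *)
Lemma vCk_ruling k : vCk k D (ruled s e) -> vCk k D (fun u _ => e u).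
Proof.
assert (K : forall c : E3 -> R, (forall u v, c (ruled s e u v) = c (s u) + v * c (e u)) ->
  Ck k D (fun u v => c (ruled s e u v)) -> Ck k D (fun u _ => c (e u))).
{ intros c E H.
  assert (H1 := Ck_minus D D_open k _ _ (Ck_strip_slice a b 1 k _ H) (Ck_strip_slice a b 0 k _ H)).
  apply Ck_ext with (3 := H1); auto; intros; cbv beta; rewrite !E; ring. }
intros (A & B & C); split; [|split]; apply K; auto.
Qed.

Hypothesis s_C3 : vCk 3 D (fun u _ => s u).
Hypothesis e_C3 : vCk 3 D (fun u _ => e u).

Local Notation x := (ruled s e).
Local Notation s' := (vDerive s).
Local Notation e' := (vDerive e).
Local Notation s'' := (vDerive s').
Local Notation e'' := (vDerive e').

Let s'_C2 : vCk 2 D (fun u _ => s' u) := vCk_vDerive 2 s s_C3.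
Let e'_C2 : vCk 2 D (fun u _ => e' u) := vCk_vDerive 2 e e_C3.
Let s''_C1 : vCk 1 D (fun u _ => s'' u) := vCk_vDerive 1 s' s'_C2.
Let e''_C1 : vCk 1 D (fun u _ => e'' u) := vCk_vDerive 1 e' e'_C2.

Definition tangent (i : idx) (u v : R) : E3 :=
  match i with i1 => ruled s' e' u v | i2 => e u end.

(** Second partial derivatives in closed form, which exposes the symmetry in j and i and the affine
    dependence on v. *)
Definition tangent_d (j i : idx) (u v : R) : E3 :=
  match j, i with i1, i1 => ruled s'' e'' u v | i2, i2 => zero | _, _ => e' u end.

Lemma is_vpd_tangent j i u v : D u v -> is_vpd j (tangent i) u v (tangent_d j i u v).
Proof.
intros d; destruct i.
- assert (H := is_vpd_ruled 1 s' e' j u v s'_C2 e'_C2 d); destruct j; exact H.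
- assert (H := is_vpd_along 2 e j u v e_C3 d); destruct j; exact H.
Qed.

Lemma vpd_ruled i u v : D u v -> vpd i x u v = tangent i u v.
Proof.
intros d; apply is_vpd_unique.
assert (H := is_vpd_ruled 2 s e i u v s_C3 e_C3 d); destruct i; exact H.
Qed.

Lemma vpd_vpd_ruled j i u v : D u v -> vpd j (vpd i x) u v = tangent_d j i u v.
Proof.
intros d; apply is_vpd_unique, is_vpd_ext with D (tangent i); auto.
- intros; symmetry; apply vpd_ruled; auto.
- apply is_vpd_tangent; auto.
Qed.

(** * The unnormalized normal N and its length w *)

Definition normal (u v : R) : E3 := cross (tangent i1 u v) (tangent i2 u v).

Definition normal_d (i : idx) (u v : R) : E3 :=
  plus (cross (tangent_d i i1 u v) (tangent i2 u v))
       (cross (tangent i1 u v) (tangent_d i i2 u v)).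

Lemma is_vpd_normal i u v : D u v -> is_vpd i normal u v (normal_d i u v).
Proof. intros d; apply is_vpd_cross; apply is_vpd_tangent; exact d. Qed.

Lemma vCk_tangent_d j i : vCk 1 D (tangent_d j i).
Proof.
destruct j, i; cbn.
- apply vCk_ruled; assumption.
- apply vCk_pred; assumption.
- apply vCk_pred; assumption.
- split; [|split]; exact (Ck_const D D_open 1 0).
Qed.

Lemma vCk_tangent i : vCk 1 D (tangent i).
Proof.
destruct i; cbn.
- apply vCk_ruled; apply vCk_pred; assumption.
- do 2 (apply vCk_pred; [assumption|]); assumption.
Qed.

Lemma vCk_normal : vCk 1 D normal.
Proof. apply vCk_cross; auto; apply vCk_tangent. Qed.

Lemma vCk_normal_d i : vCk 1 D (normal_d i).
Proof. apply vCk_plus; auto; apply vCk_cross; auto using vCk_tangent, vCk_tangent_d. Qed.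

Lemma dot_normal_tangent i u v : dot (normal u v) (tangent i u v) = 0.
Proof. destruct i; [apply dot_cross_l | apply dot_cross_r]. Qed.

Lemma dot_unit_normal c u v : D u v ->
  dot (unit_normal x u v) c = dot (normal u v) c / enorm (normal u v).
Proof.
intros d; unfold unit_normal; rewrite !vpd_ruled by auto; fold (normal u v).
rewrite dot_scal_l; unfold Rdiv; ring.
Qed.

Local Notation dlt := (delta s e).

(** Since x_{/12} = e', this computes w h_12. *)
Lemma dot_normal_e' u v : dot (normal u v) (e' u) = dlt u.
Proof. unfold normal, delta; cbn [tangent]; unfold ruled; E3_ring. Qed.

Hypothesis e_unit : forall u v, D u v -> dot (e u) (e u) = 1.
Hypothesis e'_unit : forall u v, D u v -> dot (e' u) (e' u) = 1.
Hypothesis striction : forall u v, D u v -> dot (s' u) (e' u) = 0.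

Lemma unit_dot_vDerive (f : R -> E3) u v : vCk 1 D (fun u _ => f u) ->
  (forall u v, D u v -> dot (f u) (f u) = 1) -> D u v -> dot (vDerive f u) (f u) = 0.
Proof.
intros C U d; assert (V := is_vpd_along 0 f i1 u v C d).
assert (P := is_pd_unique _ _ _ _ _ (is_pd_dot _ _ _ _ _ _ _ V V)).
rewrite (pd_ext D i1 _ (fun _ _ => 1) u v D_open d) in P by auto.
rewrite (is_pd_unique _ _ _ _ _ (is_pd_const i1 1 u v)) in P.
cbn [along] in P; rewrite (dot_comm (f u)) in P; lra.
Qed.

Lemma dot_e_e' u v : D u v -> dot (e u) (e' u) = 0.
Proof.
intros d; rewrite dot_comm; apply unit_dot_vDerive with v; auto.
apply (vCk_le D D_open 1 3); auto.
Qed.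

Lemma dot_e''_e' u v : D u v -> dot (e'' u) (e' u) = 0.
Proof. intros d; apply unit_dot_vDerive with v; auto; apply vCk_pred; auto. Qed.

(* All three vectors are orthogonal to the central normal e'. *)
Lemma triple_s'_e_e'' u v : D u v -> triple (s' u) (e u) (e'' u) = 0.
Proof.
intros d; apply triple_orthogonal with (e' u); eauto using dot_e_e', dot_e''_e'.
rewrite (e'_unit u v d); lra.
Qed.

(** Lagrange's identity for N and the Gram determinant for delta both reduce to |s'|^2 - <s', e>^2,
    the former with v^2 added. *)
Lemma normal_sqr u v : D u v -> dot (normal u v) (normal u v) = dlt u ^ 2 + v ^ 2.
Proof.
intros d; unfold normal, delta; rewrite lagrange, triple_sqr.
assert (A := e_unit u v d); assert (B := e'_unit u v d).
assert (C := striction u v d); assert (E := dot_e_e' u v d).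
cbn [tangent]; unfold ruled.
assert (F : dot (plus (s' u) (scal v (e' u))) (plus (s' u) (scal v (e' u))) =
  dot (s' u) (s' u) + 2 * v * dot (s' u) (e' u) + v ^ 2 * dot (e' u) (e' u)) by E3_ring.
assert (G : dot (plus (s' u) (scal v (e' u))) (e u) =
  dot (s' u) (e u) + v * dot (e u) (e' u)) by E3_ring.
rewrite F, G, A, B, C, E; ring.
Qed.

Lemma enorm_normal u v : D u v -> enorm (normal u v) = w_fun s e u v.
Proof. intros d; unfold enorm, w_fun; rewrite normal_sqr; auto. Qed.

(** * The distribution parameter and the second fundamental form *)

Definition delta_d (u : R) : R := triple (s'' u) (e u) (e' u).

Lemma is_pd_delta i u v : D u v ->
  is_pd i (fun u _ => dlt u) u v (match i with i1 => delta_d u | i2 => 0 end).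
Proof.
intros d.
assert (S := is_vpd_along 1 s' i u v s'_C2 d).
assert (E := is_vpd_along 2 e i u v e_C3 d).
assert (E' := is_vpd_along 1 e' i u v e'_C2 d).
unfold delta, triple.
eapply is_pd_eq; [|exact (is_pd_dot _ _ _ _ _ _ _ S (is_vpd_cross _ _ _ _ _ _ _ E E'))].
destruct i; cbn [along]; [|E3_ring].
assert (T := triple_s'_e_e'' u v d); unfold delta_d.
(* Of the three product rule terms, the one containing e' twice vanishes identically and the one
   containing e'' vanishes by [T]. *)
transitivity (triple (s'' u) (e u) (e' u) + triple (s' u) (e u) (e'' u)); [E3_ring|].
rewrite T; ring.
Qed.

Lemma Ck_delta : Ck 1 D (fun u _ => dlt u).
Proof.
apply (Ck_dot D D_open 1 (fun u _ => s' u) (fun u _ => cross (e u) (e' u))).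
- apply vCk_pred; auto.
- apply (vCk_cross D D_open 1 (fun u _ => e u) (fun u _ => e' u)).
  + apply (vCk_le D D_open 1 3); auto.
  + apply vCk_pred; auto.
Qed.

(* This is w times the coefficient h_{11} of the second fundamental form. *)
Definition h11 (u v : R) : R := dot (normal u v) (tangent_d i1 i1 u v).

Definition h11_d2 (u v : R) : R :=
  dot (normal_d i2 u v) (tangent_d i1 i1 u v) + dot (normal u v) (e'' u).

Lemma is_pd_h11 u v : D u v -> is_pd i2 h11 u v (h11_d2 u v).
Proof.
intros d.
assert (H := is_vpd_ruled 0 s'' e'' i2 u v s''_C1 e''_C1 d).
exact (is_pd_dot _ _ _ _ _ _ _ (is_vpd_normal i2 u v d) H).
Qed.

Lemma Ck_h11 : Ck 1 D h11.
Proof. apply Ck_dot; auto using vCk_normal, vCk_tangent_d. Qed.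

(** Differentiation in v brings in no derivative of s or e beyond the second, so no smoothness is
    lost. This is what makes Gamma^2_12 differentiable. *)
Lemma Ck_h11_d2 : Ck 1 D h11_d2.
Proof.
apply Ck_plus; auto.
- apply Ck_dot; auto using vCk_normal_d, vCk_tangent_d.
- apply (Ck_dot D D_open 1 normal (fun u _ => e'' u)); auto using vCk_normal.
Qed.

(** As N_{/2} = e' x e, the term <N_{/2}, x_{/11}> equals -delta' + v (e', e, e''), while <N, e''> =
    v (e', e, e'') because (s', e, e'') = 0. *)
Lemma dot_normal_e'' u v : D u v ->
  2 * dot (normal u v) (e'' u) = h11_d2 u v + delta_d u.
Proof.
intros d; assert (T := triple_s'_e_e'' u v d).
enough (2 * dot (normal u v) (e'' u) = h11_d2 u v + delta_d u + triple (s' u) (e u) (e'' u)) by lra.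
unfold h11_d2, normal, normal_d, delta_d; cbn [tangent tangent_d]; unfold ruled; E3_ring.
Qed.

(** The determinant of the second fundamental form is -h_12^2 because h_22 = 0, and h_12 vanishes
    with delta. This holds for every v, so the curvature at v = 1 is enough. *)
Lemma delta_neq_0_of_curvature u v : gauss_curvature x u 1 <> 0 -> D u v -> dlt u <> 0.
Proof.
intros K [A B] Z; assert (d : D u 1) by (split; assumption); apply K.
unfold gauss_curvature, det2, fform2.
rewrite !vpd_vpd_ruled, !dot_unit_normal by auto; cbn [tangent_d].
rewrite dot_zero_r, dot_normal_e', Z; unfold Rdiv; ring.
Qed.

(** * Relative normalizations *)

Hypothesis delta_neq_0 : forall u v, D u v -> dlt u <> 0.

Variable y : R -> R -> E3.
Hypothesis y_C1 : vCk 1 D y.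

(** This is Q = w q, which avoids the square root in w. *)
Definition supp (u v : R) : R := dot (normal u v) (y u v).

Hypothesis supp_neq_0 : forall u v, D u v -> supp u v <> 0.
Hypothesis y_d_tangent : forall i u v, D u v -> dot (normal u v) (vpd i y u v) = 0.

Definition supp_d (i : idx) (u v : R) : R := dot (normal_d i u v) (y u v).

Lemma is_pd_supp i u v : D u v -> is_pd i supp u v (supp_d i u v).
Proof.
intros d.
assert (H := is_pd_dot _ _ _ _ _ _ _ (is_vpd_normal i u v d) (vCk_is_vpd 0 D y i u v y_C1 d)).
eapply is_pd_eq; [|exact H]; rewrite y_d_tangent by auto; unfold supp_d; ring.
Qed.

Lemma Ck_supp_d i : Ck 1 D (supp_d i).
Proof. apply Ck_dot; auto using vCk_normal_d. Qed.

(* Although y is only C^1, the products <N, y_{/i}> vanish, so the partial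
   derivatives <N_{/i}, y> of <N, y> are C^1. *)
Lemma Ck_supp : Ck 2 D supp.
Proof. apply Ck_of_pd with supp_d; auto using is_pd_supp, Ck_supp_d. Qed.

Lemma supp_d_comm u v : D u v ->
  pd i1 (supp_d i2) u v = pd i2 (supp_d i1) u v.
Proof.
intros d; rewrite <- (pd_ext D i1 (pd i2 supp)), <- (pd_ext D i2 (pd i1 supp)); auto.
- apply (pd_comm D); auto using Ck_supp.
- intros; apply is_pd_unique, is_pd_supp; auto.
- intros; apply is_pd_unique, is_pd_supp; auto.
Qed.

Local Notation G := (rel_metric x y).

Lemma support_eq u v : D u v -> support x y u v = supp u v / enorm (normal u v).
Proof. apply dot_unit_normal. Qed.

Lemma enorm_normal_neq_0 u v : D u v -> enorm (normal u v) <> 0.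
Proof.
intros d Z; apply (delta_neq_0 u v d).
assert (H : dlt u ^ 2 + v ^ 2 = 0).
{ rewrite <- normal_sqr by auto; rewrite <- (sqrt_def (dot (normal u v) (normal u v))).
  - fold (enorm (normal u v)); rewrite Z; ring.
  - rewrite normal_sqr by auto; nra. }
nra.
Qed.

(** The factor w cancels between q and the unit normal, which removes every square root from the
    metric and the Darboux tensor. *)
Lemma support_dot_unit_normal c u v : D u v ->
  / support x y u v * dot (unit_normal x u v) c = dot (normal u v) c / supp u v.
Proof.
intros d; rewrite support_eq, dot_unit_normal by auto.
field; auto using enorm_normal_neq_0.
Qed.

(** * The relative metric and its inverse *)

Definition h_coef (j i : idx) (u v : R) : R := dot (normal u v) (tangent_d j i u v).

Lemma h_coef_values u v : h_coef i1 i1 u v = h11 u v /\ h_coef i1 i2 u v = dlt u /\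
  h_coef i2 i1 u v = dlt u /\ h_coef i2 i2 u v = 0.
Proof.
unfold h_coef; cbn [tangent_d]; rewrite !dot_normal_e', dot_zero_r; auto.
Qed.

Lemma rel_metric_eq i j u v : D u v -> G i j u v = h_coef j i u v / supp u v.
Proof.
intros d; unfold rel_metric, fform2; rewrite support_dot_unit_normal, vpd_vpd_ruled by auto.
reflexivity.
Qed.

Lemma rel_metric_values u v : D u v ->
  G i1 i1 u v = h11 u v / supp u v /\ G i1 i2 u v = dlt u / supp u v /\
  G i2 i1 u v = dlt u / supp u v /\ G i2 i2 u v = 0.
Proof.
intros d; destruct (h_coef_values u v) as (A & B & C & E).
rewrite !rel_metric_eq by auto; rewrite A, B, C, E; repeat split; unfold Rdiv; ring.
Qed.

Lemma inv2_values u v : D u v ->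
  inv2 G i1 i1 u v = 0 /\ inv2 G i1 i2 u v = supp u v / dlt u /\
  inv2 G i2 i1 u v = supp u v / dlt u /\
  inv2 G i2 i2 u v = - h11 u v * supp u v / dlt u ^ 2.
Proof.
intros d; assert (Z := delta_neq_0 u v d); assert (S := supp_neq_0 u v d).
unfold inv2, det2; destruct (rel_metric_values u v d) as (-> & -> & -> & ->).
repeat split; field; auto.
Qed.

Lemma pd_rel_metric_22 k u v : D u v -> pd k (G i2 i2) u v = 0.
Proof.
intros d; rewrite (pd_ext D k _ (fun _ _ => 0) u v D_open d).
- apply is_pd_unique, is_pd_const.
- intros; apply rel_metric_values; auto.
Qed.

Lemma pd_rel_metric_12 k i j u v : i <> j -> D u v -> pd k (G i j) u v =
  (match k with i1 => delta_d u | i2 => 0 end * supp u v - dlt u * supp_d k u v) / supp u v ^ 2.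
Proof.
intros ij d; rewrite (pd_ext D k _ (fun u v => dlt u / supp u v) u v D_open d).
- apply is_pd_unique, (is_pd_div k (fun u _ => dlt u)); auto using is_pd_delta, is_pd_supp.
- intros p q pq; destruct i, j; try congruence; apply rel_metric_values; auto.
Qed.

Lemma pd2_rel_metric_11 u v : D u v -> pd i2 (G i1 i1) u v =
  (h11_d2 u v * supp u v - h11 u v * supp_d i2 u v) / supp u v ^ 2.
Proof.
intros d; rewrite (pd_ext D i2 _ (fun u v => h11 u v / supp u v) u v D_open d).
- apply is_pd_unique, is_pd_div; auto using is_pd_h11, is_pd_supp.
- intros; apply rel_metric_values; auto.
Qed.

(** * Christoffel symbols of the relative metric *)

(* [gamma12] and [gamma22] are Gamma^2_{12} and Gamma^2_{22}. *)
Definition gamma12 (u v : R) : R :=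
  (h11_d2 u v - h11 u v * (supp_d i2 u v / supp u v)) / (2 * dlt u).

Definition gamma22 (u v : R) : R := (-1) * (supp_d i2 u v / supp u v).

(** The entry for the pair (1, 1) is a filler and not Gamma^2_11; statements that read [gamma] as a
    Christoffel symbol assume [not_11]. *)
Definition gamma (j i : idx) : R -> R -> R :=
  match j, i with i2, i2 => gamma22 | _, _ => gamma12 end.

Lemma Ck_gamma j i : Ck 1 D (gamma j i).
Proof.
assert (Q : Ck 1 D (fun u v => supp_d i2 u v / supp u v)).
{ apply Ck_div; auto using Ck_supp_d, Ck_pred, Ck_supp. }
assert (A : Ck 1 D gamma12).
{ apply (Ck_div D D_open 1 _ (fun u _ => 2 * dlt u)).
  - intros u v d; generalize (delta_neq_0 u v d); lra.
  - apply Ck_minus; auto using Ck_h11_d2. apply Ck_mult; auto using Ck_h11.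
  - apply (Ck_mult D D_open 1 (fun _ _ => 2) (fun u _ => dlt u)); auto using Ck_const, Ck_delta. }
assert (B : Ck 1 D gamma22) by (apply Ck_mult; auto using Ck_const).
destruct j, i; assumption.
Qed.

Definition not_11 (j i : idx) : Prop := match j, i with i1, i1 => False | _, _ => True end.

(** With G^11 = 0, Gamma^1_{ji} is a multiple of the bracket with l = 2, which cancels for these
    indices because G_22 = 0. *)
Lemma christoffel_eq j i u v : not_11 j i -> D u v ->
  christoffel G i1 j i u v = 0 /\ christoffel G i2 j i u v = gamma j i u v.
Proof.
intros ji d; assert (Z := delta_neq_0 u v d); assert (S := supp_neq_0 u v d).
destruct (inv2_values u v d) as (A & B & C & E).
unfold christoffel, isum; rewrite A, B, C, E.
destruct j, i; try contradiction; cbn [gamma]; unfold gamma12, gamma22;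
  rewrite ?pd_rel_metric_22, ?pd2_rel_metric_11, ?pd_rel_metric_12 by (auto; discriminate);
  split; field; auto.
Qed.

Lemma christoffel_1_11 u v : D u v -> christoffel G i1 i1 i1 u v =
  delta_d u / dlt u - supp_d i1 u v / supp u v - gamma12 u v.
Proof.
intros d; assert (Z := delta_neq_0 u v d); assert (S := supp_neq_0 u v d).
destruct (inv2_values u v d) as (A & B & C & E).
unfold christoffel, isum, gamma12; rewrite A, B.
rewrite ?pd_rel_metric_22, ?pd2_rel_metric_11, ?(pd_rel_metric_12 _ i1 i2) by (auto; discriminate).
field; auto.
Qed.

(** * The Darboux tensor *)

Local Notation W := (cov1 G (fun l => vpd l x)).

(** The Christoffel terms are tangential, so N does not see them; this covers the pair (1, 1) as
    well. *)
Lemma dot_normal_cov1 j i u v : D u v -> dot (normal u v) (W j i u v) = h_coef j i u v.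
Proof.
intros d; unfold cov1, vsum.
rewrite vpd_vpd_ruled, !vpd_ruled, dot_minus_r, dot_plus_r, !dot_scal_r by auto.
rewrite !dot_normal_tangent; unfold h_coef; ring.
Qed.

Lemma cov1_eq j i u v : not_11 j i -> D u v ->
  W j i u v = minus (tangent_d j i u v) (scal (gamma j i u v) (e u)).
Proof.
intros ji d; unfold cov1, vsum.
rewrite vpd_vpd_ruled, !vpd_ruled by auto.
destruct (christoffel_eq j i u v ji d) as [-> ->].
apply E3_ext; cbn [tangent]; coords; ring.
Qed.

(** Third partial derivatives of the surface, again with a filler for the pair (1, 1). *)
Definition tangent_dd (k j i : idx) (u : R) : E3 :=
  match j, i with i2, i2 => zero | _, _ => along k e' u end.

(** The product rule needs [gamma] differentiable, but its derivative multiplies e, which is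
    orthogonal to N, and so drops out. *)
Lemma dot_normal_vpd_cov1 k j i u v : not_11 j i -> D u v ->
  dot (normal u v) (vpd k (W j i) u v) =
  dot (normal u v) (tangent_dd k j i u) - gamma j i u v * dot (normal u v) (along k e u).
Proof.
intros ji d.
assert (T : is_vpd k (tangent_d j i) u v (tangent_dd k j i u)).
{ destruct j, i; try contradiction; cbn [tangent_dd].
  - exact (is_vpd_along 1 e' k u v e'_C2 d).
  - exact (is_vpd_along 1 e' k u v e'_C2 d).
  - exact (is_vpd_const k zero u v). }
assert (E := is_vpd_along 2 e k u v e_C3 d).
assert (H := is_vpd_minus _ _ _ _ _ _ _ T
  (is_vpd_scal _ _ _ _ _ _ _ (Ck_is_pd 0 D _ k u v (Ck_gamma j i) d) E)).
rewrite (is_vpd_unique k (W j i) u v _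
  (is_vpd_ext D k _ _ u v _ D_open d (fun u v d => eq_sym (cov1_eq j i u v ji d)) H)).
rewrite dot_minus_r, dot_plus_r, !dot_scal_r.
assert (N : dot (normal u v) (e u) = 0) by apply (dot_normal_tangent i2).
rewrite N; ring.
Qed.

Lemma darboux_eq i j k u v : not_11 j i -> D u v -> darboux x y i j k u v =
  (dot (normal u v) (tangent_dd k j i u) - gamma j i u v * dot (normal u v) (along k e u)
   - isum (fun m => christoffel G m k j u v * h_coef m i u v)
   - isum (fun m => christoffel G m k i u v * h_coef j m u v)) / supp u v.
Proof.
intros ji d; unfold darboux; rewrite support_dot_unit_normal by auto.
unfold cov2, vsum, isum.
rewrite dot_minus_r, !dot_plus_r, !dot_scal_r, !dot_normal_cov1 by auto.
rewrite dot_normal_vpd_cov1 by auto; f_equal; ring.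
Qed.

Lemma darboux_values u v : D u v ->
  darboux x y i2 i2 i2 u v = 0 /\
  darboux x y i1 i2 i2 u v = dlt u * supp_d i2 u v / supp u v ^ 2 /\
  darboux x y i2 i1 i2 u v = dlt u * supp_d i2 u v / supp u v ^ 2 /\
  darboux x y i2 i2 i1 u v = dlt u * supp_d i2 u v / supp u v ^ 2 /\
  darboux x y i1 i2 i1 u v = darboux x y i2 i1 i1 u v /\
  darboux x y i2 i1 i1 u v =
    (dlt u * supp_d i1 u v / supp u v - delta_d u / 2
     + h11 u v * (supp_d i2 u v / supp u v) / 2) / supp u v.
Proof.
intros d; assert (Z := delta_neq_0 u v d); assert (S := supp_neq_0 u v d).
destruct (christoffel_eq i1 i2 u v I d) as [A1 A2].
destruct (christoffel_eq i2 i1 u v I d) as [B1 B2].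
destruct (christoffel_eq i2 i2 u v I d) as [C1 C2].
assert (E := christoffel_1_11 u v d).
destruct (h_coef_values u v) as (H1 & H2 & H3 & H4).
rewrite !darboux_eq by (auto; exact I); unfold isum.
(* Gamma^2_11 stays uncomputed: it occurs only with the factor h_22 = 0. *)
rewrite A1, A2, B1, B2, C1, C2, E, H1, H2, H3, H4.
cbn [along tangent_dd gamma]; rewrite !dot_zero_r, !dot_normal_e'.
assert (F := dot_normal_e'' u v d).
(* This substitution cancels [h11_d2] against the one in [gamma12] and turns -delta' into -delta' /
   2. *)
assert (F' : dot (normal u v) (e'' u) = (h11_d2 u v + delta_d u) / 2) by lra.
rewrite F'; unfold gamma12, gamma22.
repeat split; field; auto.
Qed.

(** * The Tchebychev vector field and its rotation *)

(* The covariant components T_i of the Tchebychev vector. *)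
Definition potential_d (i : idx) (u v : R) : R :=
  supp_d i u v / supp u v - match i with i1 => delta_d u / (2 * dlt u) | i2 => 0 end.

Lemma tchebychev_gradient m u v : D u v ->
  tchebychev x y m u v = isum (fun j => inv2 G m j u v * potential_d j u v).
Proof.
intros d; assert (Z := delta_neq_0 u v d); assert (S := supp_neq_0 u v d).
destruct (inv2_values u v d) as (A & B & C & E).
destruct (darboux_values u v d) as (D1 & D2 & D3 & D4 & D5 & D6).
unfold tchebychev, isum, potential_d.
(* The components A_11k, for which no value was derived, are multiplied by G^11 = 0. *)
destruct m; rewrite A, B, C, E, D1, D2, D3, D4, D5, D6; field; auto.
Qed.

Lemma curl_tchebychev u v : D u v -> curl G (tchebychev x y) u v = 0.
Proof.
intros d; unfold curl.
(* Lowering the index of T turns the two bracketed functions into the covariant components. The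
   delta term of T_1 is constant in v, and the Q terms agree by Schwarz. *)
rewrite (pd_ext D i1 _ (potential_d i2) u v D_open d), (pd_ext D i2 _ (potential_d i1) u v D_open d).
- assert (S := supp_neq_0 u v d); assert (Z := delta_neq_0 u v d).
  assert (P : forall i j, is_pd i (fun u v => supp_d j u v / supp u v) u v
    ((pd i (supp_d j) u v * supp u v - supp_d j u v * supp_d i u v) / supp u v ^ 2)).
  { intros i j; apply is_pd_div; auto using is_pd_supp.
    apply (Ck_is_pd 0 D); auto using Ck_supp_d. }
  assert (P1 : is_pd i1 (potential_d i2) u v
    ((pd i1 (supp_d i2) u v * supp u v - supp_d i2 u v * supp_d i1 u v) / supp u v ^ 2 - 0))
    by exact (is_pd_minus _ _ _ _ _ _ _ (P i1 i2) (is_pd_const i1 0 u v)).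
  assert (P2 : is_pd i2 (potential_d i1) u v
    ((pd i2 (supp_d i1) u v * supp u v - supp_d i1 u v * supp_d i2 u v) / supp u v ^ 2 - 0))
    by exact (is_pd_minus _ _ _ _ _ _ _ (P i2 i1) (is_pd_const i2 (delta_d u / (2 * dlt u)) u v)).
  rewrite (is_pd_unique _ _ _ _ _ P1), (is_pd_unique _ _ _ _ _ P2), supp_d_comm by auto.
  unfold Rdiv; ring.
- clear u v d; intros u v d; assert (S := supp_neq_0 u v d); assert (Z := delta_neq_0 u v d).
  destruct (inv2_values u v d) as (A & B & C & E).
  rewrite !tchebychev_gradient by auto; unfold isum; rewrite A, B, C, E.
  destruct (rel_metric_values u v d) as (R1 & R2 & _ & R4); rewrite ?R1, ?R2, ?R4; field; auto.
- clear u v d; intros u v d; assert (S := supp_neq_0 u v d); assert (Z := delta_neq_0 u v d).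
  destruct (inv2_values u v d) as (A & B & C & E).
  rewrite !tchebychev_gradient by auto; unfold isum; rewrite A, B, C, E.
  destruct (rel_metric_values u v d) as (R1 & R2 & _ & R4); rewrite ?R1, ?R2, ?R4; field; auto.
Qed.

(** * The potential and its uniqueness up to a constant *)

Definition potential (u v : R) : R :=
  ln (Rabs (w_fun s e u v * support x y u v / sqrt (Rabs (dlt u)))).

(** The absolute value in [potential] allows for a negative support function. Rewriting ln |t| as
    half of ln t^2 makes the expression differentiable by direct rules for both signs. *)
Lemma potential_eq u v : D u v ->
  potential u v = / 2 * ln (supp u v * supp u v) - / 4 * ln (dlt u * dlt u).
Proof.
assert (ln_sqr : forall t, t <> 0 -> ln (t * t) = 2 * ln (Rabs t)).
{ intros t T; rewrite <- (Rabs_pos_eq (t * t)) by nra.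
  rewrite Rabs_mult, ln_mult by (apply Rabs_pos_lt; exact T); ring. }
intros d; assert (S := supp_neq_0 u v d); assert (Z := delta_neq_0 u v d).
assert (A : 0 < Rabs (dlt u)) by (apply Rabs_pos_lt; exact Z).
assert (B := sqrt_lt_R0 _ A).
unfold potential; rewrite support_eq, <- enorm_normal by auto.
replace (enorm (normal u v) * (supp u v / enorm (normal u v))) with (supp u v)
  by (field; apply enorm_normal_neq_0; exact d).
rewrite Rabs_div, (Rabs_pos_eq (sqrt _)) by lra.
rewrite ln_div by (auto; apply Rabs_pos_lt; exact S).
rewrite !ln_sqr by auto.
rewrite <- (sqrt_def (Rabs (dlt u))) at 2 by lra.
rewrite ln_mult by exact B; field.
Qed.

Lemma is_pd_potential i u v : D u v -> is_pd i potential u v (potential_d i u v).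
Proof.
intros d; assert (S := supp_neq_0 u v d); assert (Z := delta_neq_0 u v d).
apply is_pd_ext with D (fun u v => / 2 * ln (supp u v * supp u v) - / 4 * ln (dlt u * dlt u)); auto.
{ intros; symmetry; apply potential_eq; auto. }
assert (L : forall t, t <> 0 -> is_derive (fun t => ln (t * t)) t (2 / t)).
{ intros t T; auto_derive; [nra | field; exact T]. }
assert (A := is_pd_comp i _ _ _ _ _ _ (L _ S) (is_pd_supp i u v d)).
assert (B := is_pd_comp i (fun t => ln (t * t)) (fun u _ => dlt u) u v _ _ (L _ Z) (is_pd_delta i u v d)).
eapply is_pd_eq; [|exact (is_pd_minus _ _ _ _ _ _ _
  (is_pd_mult _ _ _ _ _ _ _ (is_pd_const i (/ 2) u v) A)
  (is_pd_mult _ _ _ _ _ _ _ (is_pd_const i (/ 4) u v) B))].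
unfold potential_d; cbv beta; destruct i; field; auto.
Qed.

(** Since G^11 = 0, the system is triangular: its first equation determines the second component,
    and the second equation then determines the first. *)
Lemma gradient_inj (f g : idx -> R) u v : D u v ->
  (forall i, isum (fun j => inv2 G i j u v * f j) = isum (fun j => inv2 G i j u v * g j)) ->
  forall j, f j = g j.
Proof.
intros d H; assert (H1 := H i1); assert (H2 := H i2); revert H1 H2; unfold isum.
destruct (inv2_values u v d) as (-> & -> & -> & _).
assert (P : supp u v / dlt u <> 0).
{ apply Rmult_integral_contrapositive; split; [auto|].
  apply Rinv_neq_0_compat; apply delta_neq_0 with v; exact d. }
intros H1 H2.
assert (K2 : f i2 = g i2) by (apply Rmult_eq_reg_l with (supp u v / dlt u); lra).
rewrite K2 in H2.
intros [|]; [|exact K2]; apply Rmult_eq_reg_l with (supp u v / dlt u); lra.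
Qed.

(** Two points of the strip are joined by a segment in v followed by one in u, both inside the
    strip; the mean value theorem applies on each. *)
Lemma is_pd_zero_constant f : (forall i u v, D u v -> is_pd i f u v 0) ->
  forall u v u' v', D u v -> D u' v' -> f u v = f u' v'.
Proof.
assert (K : forall (g : R -> R) p q,
  (forall t, Rmin p q <= t <= Rmax p q -> is_derive g t 0) -> g p = g q).
{ intros g p q H.
  destruct (MVT_gen g p q (fun _ => 0)) as [c [_ E]].
  - intros t T; apply H; lra.
  - intros t T; apply continuity_pt_filterlim, (ex_derive_continuous g); exists 0; auto.
  - lra. }
intros H u v u' v' [A B] [A' B'].
transitivity (f u v').
- apply (K (f u)); intros t _; apply (H i2); split; assumption.
- apply (K (fun t => f t v')); intros t T; apply (H i1).
  unfold Rmin, Rmax in T; split; destruct (Rle_dec u u').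
  + apply Rbar_lt_le_trans with u; [exact A|exact (proj1 T)].
  + apply Rbar_lt_le_trans with u'; [exact A'|exact (proj1 T)].
  + apply Rbar_le_lt_trans with u'; [exact (proj2 T)|exact B'].
  + apply Rbar_le_lt_trans with u; [exact (proj2 T)|exact B].
Qed.

(** Two functions with the same gradient have the same partial derivatives by [gradient_inj], so
    their difference is constant on the strip; a base point with v = 0 supplies the constant. *)
Lemma is_potential_iff (hI : Rbar_lt a b) tau :
  is_potential D G (tchebychev x y) tau <->
  exists c : R, forall u v, D u v -> tau u v = potential u v + c.
Proof.
split.
- intros H.
  assert (Z : forall i u v, D u v -> is_pd i (fun u v => tau u v - potential u v) u v 0).
  { intros i u v d; destruct (H u v d) as (E1 & E2 & E3).
    assert (K : pd i tau u v = potential_d i u v).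
    { apply (gradient_inj (fun j => pd j tau u v) (fun j => potential_d j u v) u v d).
      intros m; rewrite <- E3; apply tchebychev_gradient; exact d. }
    assert (P : is_pd i tau u v (pd i tau u v)) by (destruct i; apply Derive_correct; assumption).
    eapply is_pd_eq; [|exact (is_pd_minus _ _ _ _ _ _ _ P (is_pd_potential i u v d))].
    rewrite K; ring. }
  destruct (strip_inhabited a b 0 hI) as [p P]; exists (tau p 0 - potential p 0); intros u v d.
  assert (K := is_pd_zero_constant _ Z u v p 0 d P); cbv beta in K; lra.
- intros [c H] u v d.
  assert (P : forall i, is_pd i tau u v (potential_d i u v)).
  { intros i; apply is_pd_ext with D (fun u v => potential u v + c); auto.
    { intros; symmetry; auto. }
    eapply is_pd_eq; [|exact (is_pd_plus _ _ _ _ _ _ _ (is_pd_potential i u v d) (is_pd_const i c u v))].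
    ring. }
  repeat split; [eexists; exact (P i1) | eexists; exact (P i2) |].
  intros m; rewrite tchebychev_gradient by auto; unfold isum.
  rewrite !(is_pd_unique _ _ _ _ _ (P _)); reflexivity.
Qed.

End Ruled.

(** * From the geometric assumptions to the analytic hypotheses, and the conclusion *)

Theorem proposition4p1 (a b : Rbar) (r k : nat) (s e : R -> E3)
    (y : R -> R -> E3)
    (hI : Rbar_lt a b) (hr : (3 <= r)%nat) (hk : (1 <= k < r)%nat)
    (hPhi : skew_ruled_surface r a b s e)
    (hy : relative_normalization k (strip a b) (ruled s e) y)
    (hpolar : polar (strip a b) s e y) :
  let x := ruled s e in
  let q := support x y in
  let G := rel_metric x y in
  let T := tchebychev x y in
  (forall u v : R, strip a b u v -> curl G T u v = 0) /\
  (forall tau : R -> R -> R,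
     is_potential (strip a b) G T tau <->
     exists c : R, forall u v : R, strip a b u v ->
       tau u v =
         ln (Rabs (w_fun s e u v * q u v / sqrt (Rabs (delta s e u)))) + c).
Proof.
destruct hPhi as [Hx _ _ He He' Hs Hk], hy as [Hy Hrank].
assert (O := strip_open a b).
assert (x3 := vCk_le _ O 3 r _ hr Hx).
assert (s3 := vCk_directrix a b s e 3 x3); assert (e3 := vCk_ruling a b s e 3 x3).
assert (y1 := vCk_le _ O 1 k _ (proj1 hk) Hy).
assert (U : forall u v, strip a b u v -> dot (e u) (e u) = 1)
  by (intros u v [A B]; apply enorm_eq_1; exact (He u A B)).
assert (U' : forall u v, strip a b u v -> dot (vDerive e u) (vDerive e u) = 1)
  by (intros u v [A B]; apply enorm_eq_1; exact (He' u A B)).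
assert (S : forall u v, strip a b u v -> dot (vDerive s u) (vDerive e u) = 0)
  by (intros u v [A B]; exact (Hs u A B)).
assert (Z : forall u v, strip a b u v -> delta s e u <> 0).
{ intros u v d; apply (delta_neq_0_of_curvature a b s e s3 e3 u v); auto. }
assert (N : forall u v, strip a b u v -> dot (normal s e u v) (normal s e u v) <> 0).
{ intros u v d; rewrite (normal_sqr a b s e e3 U U' S u v d).
  assert (K := Z u v d); assert (0 < delta s e u ^ 2) by nra; nra. }
assert (Q : forall u v, strip a b u v -> supp s e y u v <> 0).
{ intros u v d; apply rank_3_triple; [exact (N u v d)|].
  generalize (proj1 (Hrank u v d)); rewrite !(vpd_ruled a b s e s3 e3 _ u v d); auto. }
assert (T : forall i u v, strip a b u v -> dot (normal s e u v) (vpd i y u v) = 0).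
{ intros i u v d; apply rank_2_triple.
  generalize (proj2 (Hrank u v d) i); rewrite !(vpd_ruled a b s e s3 e3 _ u v d); auto. }
intros x q G t; split.
- exact (curl_tchebychev a b s e s3 e3 U U' S Z y y1 Q T).
- exact (is_potential_iff a b s e s3 e3 U U' S Z y y1 Q T hI).
Qed.
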